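(* Let $d,g\in\mathcal{F}_0$ with $d(0)=1$ and let $f\in\mathcal{F}_1$. Let $J$ be the production matrix of the almost-Riordan array $(d\,|\,g,f)$. If $J$ is totally positive, then both the almost-Riordan array $(d\,|\,g,f)$ and the Riordan array $(g,f)$ are totally positive.
   Context: For $k\ge 0$, $\mathcal{F}_k$ denotes the set of formal power series $\sum_{n\ge k}a_nt^n$ with real coefficients and $a_k\neq 0$. All matrices are infinite, with rows and columns indexed by $0,1,2,\dots$; writing a matrix as a list $(u_0,u_1,u_2,\dots)$ of formal power series means that the $(n,k)$ entry is the coefficient of $t^n$ in $u_k$. The Riordan array is $(g,f)=(g,gf,gf^2,\dots)$, and the almost-Riordan array is $(d\,|\,g,f)=(d,tg,tgf,tgf^2,\dots)$. An infinite matrix is totally positive (TP) if its minors of all orders are nonnegative. Write $d=\sum d_nt^n$, $g=\sum g_nt^n$, with $d_0=1$, and let $\overline f$ be the compositional inverse of $f$. The $A$-, $Z$- and $W$-sequences $(a_n),(z_n),(w_n)$ of $(d\,|\,g,f)$ are those with generating functions $$A(t)=\frac{t}{\overline f(t)},\qquad Z(t)=\frac{t\,\bigl(g(\overline f(t))-z_0d(\overline f(t))\bigr)}{\overline f(t)\,g(\overline f(t))}+z_0,\qquad W(t)=\frac{t\,\bigl(d(\overline f(t))-d_0-w_0\overline f(t)d(\overline f(t))\bigr)}{(\overline f(t))^2\,g(\overline f(t))}+w_0,$$ where $z_0=g_0$ and $w_0=d_1$. The production matrix of $(d\,|\,g,f)$ is $$J=\begin{bmatrix} w_0&z_0&&&\\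 w_1&z_1&a_0&&\\ w_2&z_2&a_1&a_0&\\ w_3&z_3&a_2&a_1&a_0\\ \vdots&\vdots&\vdots&\vdots&\vdots&\ddots\end{bmatrix},$$ i.e. the columns of $J$ have generating functions $W(t),Z(t),tA(t),t^2A(t),t^3A(t),\dots$. It satisfies $(d\,|\,g,f)\,J=\overline{(d\,|\,g,f)}$, where $\overline{(d\,|\,g,f)}$ is $(d\,|\,g,f)$ with its first row deleted. *)

(* Defs.v *)
From HB Require Import structures.
From mathcomp Require Import all_boot all_order all_algebra.
From mathcomp Require Import boolp classical_sets reals.

Set Implicit Arguments.
Unset Strict Implicit.
Unset Printing Implicit Defensive.

Import Order.TTheory GRing.Theory Num.Theory.
Local Open Scope ring_scope.

(* A record rather than a bare [nat -> R], so that [*] is the Cauchy product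
   and cannot be confused with the pointwise product of functions. *)
Record fps (R : Type) := FPS { fps_coef :> nat -> R }.

Lemma fps_ext (R : Type) (a b : fps R) : (forall n, a n = b n) -> a = b.
Proof. by case: a b => [a] [b] /= ab; congr FPS; apply/funext. Qed.

HB.instance Definition _ (R : Type) := gen_eqMixin (fps R).
HB.instance Definition _ (R : Type) := gen_choiceMixin (fps R).

Definition fps_const (R : nzRingType) (c : R) : fps R :=
  FPS (fun n => if n == 0%N then c else 0).
Definition fps_opp (R : nzRingType) (a : fps R) : fps R := FPS (fun n => - a n).
Definition fps_add (R : nzRingType) (a b : fps R) : fps R :=
  FPS (fun n => a n + b n).
Definition fps_mul (R : nzRingType) (a b : fps R) : fps R :=
  FPS (fun n => \sum_(i < n.+1) a i * b (n - i)%N).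

Fact fps_addA (R : nzRingType) : associative (@fps_add R).
Proof. by move=> a b c; apply: fps_ext => n /=; rewrite addrA. Qed.
Fact fps_addC (R : nzRingType) : commutative (@fps_add R).
Proof. by move=> a b; apply: fps_ext => n /=; rewrite addrC. Qed.
Fact fps_add0 (R : nzRingType) : left_id (fps_const 0) (@fps_add R).
Proof. by move=> a; apply: fps_ext => n /=; case: ifP; rewrite add0r. Qed.
Fact fps_addN (R : nzRingType) :
  left_inverse (fps_const 0) (@fps_opp R) (@fps_add R).
Proof. by move=> a; apply: fps_ext => n /=; case: ifP; rewrite addNr. Qed.

HB.instance Definition _ (R : nzRingType) := GRing.isZmodule.Build (fps R)
  (@fps_addA R) (@fps_addC R) (@fps_add0 R) (@fps_addN R).

Definition fps_trunc (R : nzRingType) (m : nat) (a : fps R) : {poly R} :=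
  \poly_(i < m) a i.

Fact fps_mul_trunc (R : nzRingType) (m n : nat) (a b : fps R) : (n < m)%N ->
  fps_mul a b n = (fps_trunc m a * fps_trunc m b)`_n.
Proof.
move=> nm; rewrite coefM; apply: eq_bigr => i _; rewrite !coef_poly.
have -> : (i < m)%N by apply: leq_ltn_trans nm; rewrite -ltnS.
by have -> : (n - i < m)%N by apply: leq_ltn_trans nm; apply: leq_subr.
Qed.

Fact fps_mulC (R : comNzRingType) : commutative (@fps_mul R).
Proof.
move=> a b; apply: fps_ext => n.
by rewrite !(fps_mul_trunc _ _ (ltnSn n)) mulrC.
Qed.

Fact fps_mulA (R : comNzRingType) : associative (@fps_mul R).
Proof.
move=> a b c; apply: fps_ext => n.
have -> : fps_mul a (fps_mul b c) n =
    (fps_trunc n.+1 a * (fps_trunc n.+1 b * fps_trunc n.+1 c))`_n.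
  rewrite coefM; apply: eq_bigr => i _.
  by rewrite (@fps_mul_trunc _ n.+1) ?ltnS ?leq_subr// coef_poly ltn_ord.
rewrite mulrA coefM; apply: eq_bigr => i _.
by rewrite (@fps_mul_trunc _ n.+1)// coef_poly ltnS leq_subr.
Qed.

Fact fps_mul1 (R : comNzRingType) : left_id (fps_const 1) (@fps_mul R).
Proof.
move=> a; apply: fps_ext => n /=.
rewrite big_ord_recl /= mul1r subn0 big1 ?addr0// => i _.
by rewrite mul0r.
Qed.

Fact fps_mulDl (R : comNzRingType) : left_distributive (@fps_mul R) +%R.
Proof.
move=> a b c; apply: fps_ext => n /=; rewrite -big_split /=.
by apply: eq_bigr => i _; rewrite mulrDl.
Qed.

Fact fps_1neq0 (R : comNzRingType) : fps_const (1 : R) != 0.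
Proof.
apply/eqP => /(congr1 (fun a : fps R => a 0%N)) /= /eqP.
by rewrite (negPf (oner_neq0 R)).
Qed.

HB.instance Definition _ (R : comNzRingType) :=
  GRing.Zmodule_isComNzRing.Build (fps R)
    (@fps_mulA R) (@fps_mulC R) (@fps_mul1 R) (@fps_mulDl R) (@fps_1neq0 R).

Definition fps_X (R : nzRingType) : fps R :=
  FPS (fun n => if n == 1%N then 1 else 0).

Definition in_F (R : nzRingType) (k : nat) (a : fps R) : Prop :=
  (forall n, (n < k)%N -> a n = 0) /\ a k != 0.

(* [a(u(t))], meaningful only when [u 0 = 0]: then [u ^+ k] has no coefficient
   below [k], so the sum may be cut off at [k = n]. *)
Definition fps_comp (R : comNzRingType) (a u : fps R) : fps R :=
  FPS (fun n => \sum_(k < n.+1) a k * (u ^+ k) n).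

(* The compositional inverse; it exists and is unique for [f] in F_1 over a
   field (junk value [0] otherwise). *)
Definition fps_cinv (R : comNzRingType) (f : fps R) : fps R :=
  xget 0 [set u : fps R | [/\ u 0%N = 0,
                              fps_comp f u = fps_X R
                            & fps_comp u f = fps_X R]].

(* The exact quotient [a / b], where [b] need not have a nonzero constant term;
   it is unique for [b != 0] over a domain, and exists over a field as soon as
   the order of [a] is at least that of [b] (junk value [0] otherwise). *)
Definition fps_quot (R : comNzRingType) (a b : fps R) : fps R :=
  xget 0 [set c : fps R | c * b = a].

Definition infmx (R : Type) := nat -> nat -> R.

Definition infmx_of_cols (R : Type) (u : nat -> fps R) : infmx R :=
  fun n k => u k n.

Definition totally_positive (R : numDomainType) (M : infmx R) : Prop :=
  forall (m : nat) (r c : 'I_m -> nat),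
    {homo r : i j / (i < j)%N} -> {homo c : i j / (i < j)%N} ->
    0 <= \det (\matrix_(i < m, j < m) M (r i) (c j)).

Definition riordan (R : comNzRingType) (g f : fps R) : infmx R :=
  infmx_of_cols (fun k => g * f ^+ k).

Definition almost_riordan (R : comNzRingType) (d g f : fps R) : infmx R :=
  infmx_of_cols (fun k => if k is j.+1 then fps_X R * g * f ^+ j else d).

Definition A_seq (R : comNzRingType) (f : fps R) : fps R :=
  fps_quot (fps_X R) (fps_cinv f).

Definition Z_seq (R : comNzRingType) (d g f : fps R) : fps R :=
  let fb := fps_cinv f in
  let z0 := fps_const (g 0%N) in
  fps_quot (fps_X R * (fps_comp g fb - z0 * fps_comp d fb))
           (fb * fps_comp g fb) + z0.

Definition W_seq (R : comNzRingType) (d g f : fps R) : fps R :=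
  let fb := fps_cinv f in
  let d0 := fps_const (d 0%N) in
  let w0 := fps_const (d 1%N) in
  fps_quot (fps_X R * (fps_comp d fb - d0 - w0 * fb * fps_comp d fb))
           (fb ^+ 2 * fps_comp g fb) + w0.

Definition production_matrix (R : comNzRingType) (d g f : fps R) : infmx R :=
  infmx_of_cols (fun k => match k with
                          | 0 => W_seq d g f
                          | 1 => Z_seq d g f
                          | j.+2 => fps_X R ^+ j.+1 * A_seq f
                          end).

(* Main.v *)
(* Write M for the almost-Riordan array.  Its first row is (1,0,0,...) and row
   n+1 of M is row n of M times J.  Hence, by Cauchy-Binet, the minors of M with
   row indices in [1,N] are sums of products of a minor of M with row indices
   in [0,N-1] and a minor of J, while a minor that uses the row (1,0,0,...) is
   zero or equal to a smaller minor; induction on N gives the total positivity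
   of M.  The Riordan array (g,f) is M without its first row and column.

   The identity between M J and the shifted M is checked after composing the
   equations that define A, Z and W with f, which turns every compositional
   inverse into X. *)
From HB Require Import structures.
Require Import Defs.
From mathcomp Require Import all_boot all_order all_algebra all_fingroup.
From mathcomp Require Import boolp classical_sets reals.
From mathcomp Require Import ring.

Set Implicit Arguments.
Unset Strict Implicit.
Unset Printing Implicit Defensive.

Import Order.TTheory GRing.Theory Num.Theory.
Local Open Scope ring_scope.

(** * Coefficients of series, constants, and division by X *)

Lemma fps_coefM (R : comNzRingType) (a b : fps R) n :
  (a * b) n = \sum_(i < n.+1) a i * b (n - i)%N.
Proof. by []. Qed.

Lemma fps_coefD (R : nzRingType) (a b : fps R) n : (a + b) n = a n + b n.
Proof. by []. Qed.

Lemma fps_coef1 (R : comNzRingType) n : (1 : fps R) n = (n == 0%N)%:R.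
Proof. by rewrite /=; case: eqP. Qed.

Lemma fps_coef0M (R : comNzRingType) (a b : fps R) : (a * b) 0%N = a 0%N * b 0%N.
Proof. by rewrite fps_coefM big_ord1. Qed.

Lemma fps_coefCM (R : comNzRingType) (c : R) (a : fps R) n :
  (fps_const c * a) n = c * a n.
Proof.
rewrite fps_coefM big_ord_recl /= subn0 big1 ?addr0// => i _.
by rewrite mul0r.
Qed.

Lemma fps_coefXM (R : comNzRingType) (a : fps R) n :
  (fps_X R * a) n = if n is m.+1 then a m else 0.
Proof.
rewrite fps_coefM big_ord_recl /= mul0r add0r; case: n => [|n]; first by rewrite big_ord0.
rewrite big_ord_recl /= mul1r subn1 big1 ?addr0// => i _.
by rewrite mul0r.
Qed.

Lemma fps_coef_sum (R : comNzRingType) I (r : seq I) (F : I -> fps R) n :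
  (\sum_(i <- r) F i) n = \sum_(i <- r) F i n.
Proof.
elim: r => [|i r IHr]; first by rewrite !big_nil /=; case: eqP.
by rewrite !big_cons -IHr.
Qed.

(** The morphism structure on [fps_const] lets polynomials over [R] be evaluated at a series through
    [map_poly]. *)
Lemma fps_const_is_zmod_morphism (R : comNzRingType) :
  zmod_morphism (@fps_const R).
Proof.
by move=> a b; apply: fps_ext => n /=; case: eqP => // _; rewrite subr0.
Qed.

Lemma fps_const_is_monoid_morphism (R : comNzRingType) :
  monoid_morphism (@fps_const R).
Proof.
split=> [|a b]; first by apply: fps_ext.
by apply: fps_ext => n; rewrite fps_coefCM /=; case: eqP => // _; rewrite mulr0.
Qed.

HB.instance Definition _ (R : comNzRingType) :=
  GRing.isZmodMorphism.Build R (fps R) (@fps_const R)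
    (@fps_const_is_zmod_morphism R).
HB.instance Definition _ (R : comNzRingType) :=
  GRing.isMonoidMorphism.Build R (fps R) (@fps_const R)
    (@fps_const_is_monoid_morphism R).

(** Plays the role of [a / X] when [a] has no constant term. *)
Definition fps_shift (R : Type) (a : fps R) : fps R := FPS (fun n => a n.+1).

Lemma fps_shiftE (R : comNzRingType) (a : fps R) :
  a = fps_const (a 0%N) + fps_X R * fps_shift a.
Proof.
apply: fps_ext => n; rewrite fps_coefD fps_coefXM.
by case: n => [|n] /=; rewrite ?addr0 ?add0r.
Qed.

Lemma fps_XM_shift (R : comNzRingType) (a : fps R) :
  a 0%N = 0 -> a = fps_X R * fps_shift a.
Proof. by move=> a0; rewrite {1}[a]fps_shiftE a0 raddf0 add0r. Qed.

Lemma fps_shiftXM (R : comNzRingType) (a : fps R) : fps_shift (fps_X R * a) = a.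
Proof. by apply: fps_ext => n; rewrite -[LHS]/((fps_X R * a) n.+1) fps_coefXM. Qed.

Lemma fps_XMI (R : comNzRingType) : injective (fun a : fps R => fps_X R * a).
Proof.
by move=> a b /(congr1 (@fps_shift R)); rewrite !fps_shiftXM.
Qed.

Lemma fps_exp_low (R : comNzRingType) (u : fps R) k n :
  u 0%N = 0 -> (n < k)%N -> (u ^+ k) n = 0.
Proof.
move=> u0; elim: k n => // k IHk n nk.
rewrite exprS (fps_XM_shift u0) -mulrA fps_coefXM -(fps_XM_shift u0).
case: n nk => // n nk; rewrite fps_coefM big1// => i _.
by rewrite IHk ?mulr0// (leq_ltn_trans (leq_subr _ _)).
Qed.

Lemma fps_exp_diag (R : comNzRingType) (u : fps R) k :
  u 0%N = 0 -> (u ^+ k) k = u 1%N ^+ k.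
Proof.
move=> u0; elim: k => [|k IHk]; first by rewrite !expr0.
rewrite exprS (fps_XM_shift u0) -mulrA fps_coefXM -(fps_XM_shift u0).
rewrite fps_coefM big_ord_recl subn0 IHk exprS big1 ?addr0// => i _.
by rewrite fps_exp_low ?mulr0// ltn_subrL /= (leq_ltn_trans _ (ltn_ord i)).
Qed.

(** * Composition of formal power series *)

Section Composition.
Variable R : comNzRingType.
Implicit Types a b p u v : fps R.

Lemma fps_mul_exp_low p u k n : u 0%N = 0 -> (n < k)%N -> (p * u ^+ k) n = 0.
Proof.
move=> u0 nk; rewrite fps_coefM big1// => i _.
by rewrite fps_exp_low ?mulr0// (leq_ltn_trans (leq_subr _ _)).
Qed.

Lemma fps_comp_widen N a u n : u 0%N = 0 -> (n < N)%N ->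
  fps_comp a u n = \sum_(k < N) a k * (u ^+ k) n.
Proof.
move=> u0 nN; rewrite /= (big_ord_widen N (fun k => a k * (u ^+ k) n)) //.
rewrite big_mkcond; apply: eq_bigr => k _; case: ifPn => //.
by rewrite -leqNgt => nk; rewrite fps_exp_low ?mulr0.
Qed.

(* The fundamental theorem of Riordan arrays: [p * (a o u)] is the matrix
   [(p, u)] applied to the coefficient vector of [a]. *)
Lemma fps_mul_comp p a u n : u 0%N = 0 ->
  (p * fps_comp a u) n = \sum_(k < n.+1) (p * u ^+ k) n * a k.
Proof.
move=> u0; transitivity
  (\sum_(i < n.+1) \sum_(k < n.+1) p i * (a k * (u ^+ k) (n - i)%N)).
  rewrite fps_coefM; apply: eq_bigr => i _.
  by rewrite (@fps_comp_widen n.+1) ?ltnS ?leq_subr// mulr_sumr.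
rewrite exchange_big; apply: eq_bigr => k _.
rewrite fps_coefM mulr_suml; apply: eq_bigr => i _.
by rewrite [a k * _]mulrC mulrA.
Qed.

Lemma fps_comp_horner (q : {poly R}) u n : u 0%N = 0 ->
  (map_poly (@fps_const R) q).[u] n = \sum_(k < n.+1) q`_k * (u ^+ k) n.
Proof.
(* This bound covers both the full Horner sum and the cut-off of [fps_comp] at degree [n]. *)
move=> u0; set N := maxn (size q) n.+1.
rewrite (@horner_coef_wide _ N); last first.
  by rewrite (leq_trans (size_poly _ _)) ?leq_maxl.
rewrite fps_coef_sum.
have nN : (n < N)%N by rewrite leq_max ltnSn orbT.
rewrite -[RHS]/(fps_comp (FPS (fun k => q`_k)) u n) (fps_comp_widen _ u0 nN).
by apply: eq_bigr => k _; rewrite coef_map; apply: fps_coefCM.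
Qed.

Lemma fps_compM a b u : u 0%N = 0 ->
  fps_comp (a * b) u = fps_comp a u * fps_comp b u.
Proof.
move=> u0; apply: fps_ext => n.
(* Coefficients up to [n] of a composite depend only on the truncation of the outer series, and
   evaluation of polynomials is multiplicative. *)
pose T c := map_poly (@fps_const R) (fps_trunc n.+1 c).
have TE c i : (i <= n)%N -> (T c).[u] i = fps_comp c u i.
  move=> le_in; rewrite fps_comp_horner//; apply: eq_bigr => k _.
  by rewrite coef_poly (leq_trans (ltn_ord k)).
transitivity ((T a * T b).[u] n).
  rewrite -rmorphM fps_comp_horner//; apply: eq_bigr => k _.
  by rewrite -(fps_mul_trunc _ _ (ltn_ord k)).
rewrite hornerM; apply: eq_bigr => i _.
by rewrite !TE ?leq_subr// -ltnS.
Qed.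

Lemma fps_compD a b u : fps_comp (a + b) u = fps_comp a u + fps_comp b u.
Proof.
by apply: fps_ext => n /=; rewrite -big_split; apply: eq_bigr => k _; rewrite mulrDl.
Qed.

Lemma fps_compN a u : fps_comp (- a) u = - fps_comp a u.
Proof.
by apply: fps_ext => n /=; rewrite -sumrN; apply: eq_bigr => k _; rewrite mulNr.
Qed.

Lemma fps_compB a b u : fps_comp (a - b) u = fps_comp a u - fps_comp b u.
Proof. by rewrite fps_compD fps_compN. Qed.

Lemma fps_compC c u : fps_comp (fps_const c) u = fps_const c.
Proof.
apply: fps_ext => n; rewrite [LHS]big_ord_recl [X in _ + X]big1 => [|i _].
  by rewrite addr0 expr0 fps_coef1 /=; case: eqP; rewrite ?mulr1 ?mulr0.
by rewrite mul0r.
Qed.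

Lemma fps_compX u : u 0%N = 0 -> fps_comp (fps_X R) u = u.
Proof.
move=> u0; apply: fps_ext => n.
rewrite (@fps_comp_widen n.+2)// 2!big_ord_recl /= mul0r add0r mul1r.
by rewrite expr1 big1 ?addr0// => i _; rewrite mul0r.
Qed.

Lemma fps_compXn a u k : u 0%N = 0 -> fps_comp (a ^+ k) u = fps_comp a u ^+ k.
Proof.
move=> u0; elim: k => [|k IHk]; first by rewrite !expr0 fps_compC.
by rewrite !exprS fps_compM// IHk.
Qed.

Lemma fps_coefXn k n : (fps_X R ^+ k) n = (n == k)%:R.
Proof.
elim: k n => [|k IHk] n; first by rewrite fps_coef1.
by rewrite exprS fps_coefXM; case: n.
Qed.

Lemma fps_comp_X a : fps_comp a (fps_X R) = a.
Proof.
apply: fps_ext => n; rewrite /= big_ord_recr /= big1 => [|k _].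
  by rewrite fps_coefXn eqxx mulr1 add0r.
by rewrite fps_coefXn gtn_eqF ?mulr0.
Qed.

Lemma fps_comp0 a u : fps_comp a u 0%N = a 0%N.
Proof. by rewrite /= big_ord1 expr0 fps_coef1 mulr1. Qed.

Lemma fps_comp1 a u : u 0%N = 0 -> fps_comp a u 1%N = a 1%N * u 1%N.
Proof.
move=> u0; transitivity (a 0%N * (u ^+ 0) 1%N + a 1%N * (u ^+ 1) 1%N).
  by rewrite [LHS]big_ord_recl big_ord1.
by rewrite expr0 fps_coef1 mulr0 add0r expr1.
Qed.

Lemma fps_compA a u v : u 0%N = 0 -> v 0%N = 0 ->
  fps_comp (fps_comp a u) v = fps_comp a (fps_comp u v).
Proof.
move=> u0 v0; apply: fps_ext => n; transitivity
  (\sum_(k < n.+1) \sum_(j < n.+1) a j * (u ^+ j) k * (v ^+ k) n).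
  apply: eq_bigr => k _; rewrite (@fps_comp_widen n.+1)// mulr_suml.
  by apply: eq_bigr.
(* The inner sum over [k] is now the composite of [u ^+ j] with [v], hence the [j]-th power of [u]
   composed with [v]. *)
rewrite exchange_big; apply: eq_bigr => j _ /=.
rewrite -fps_compXn// mulr_sumr; apply: eq_bigr => k _.
by rewrite mulrA.
Qed.

End Composition.

(** * Triangular systems, and inverses of series over a field *)

Lemma triangular_solve (F : fieldType) (T : nat -> nat -> F) (b : nat -> F) :
  (forall n, T n n != 0) ->
  exists a : nat -> F, forall n, \sum_(k < n.+1) T n k * a k = b n.
Proof.
move=> T_neq0.
(* Forward substitution: [s n] lists the first [n] unknowns, since each new one depends on all
   earlier ones. *)
pose s := fix s n := if n is m.+1 then
  rcons (s m) ((b m - \sum_(k < m) T m k * (s m)`_k) / T m m) else [::].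
have sz_s n : size (s n) = n by elim: n => //= n IHn; rewrite size_rcons IHn.
have sE m n : (m <= n)%N -> forall k, (k < m)%N -> (s n)`_k = (s m)`_k.
  elim: n => [|n IHn]; first by case: m.
  rewrite leq_eqVlt ltnS => /predU1P[->//|le_mn] k km /=.
  by rewrite nth_rcons sz_s (leq_trans km le_mn) IHn.
exists (fun k => (s k.+1)`_k) => n.
transitivity (\sum_(k < n) T n k * (s n)`_k + T n n * (s n.+1)`_n).
  rewrite big_ord_recr; congr (_ + _); apply: eq_bigr => k _.
  by rewrite (@sE k.+1 n).
by rewrite /= nth_rcons sz_s ltnn eqxx mulrC divfK// addrC subrK.
Qed.

Section FieldSeries.
Variable F : fieldType.
Implicit Types a b f g u : fps F.

(** Multiplication by [g] is a lower triangular system with constant diagonal [g 0]. *)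
Lemma fps_inv_exists g : g 0%N != 0 -> exists h, g * h = 1.
Proof.
move=> g0; have [n|h hE] := @triangular_solve _ (fun n k => g (n - k)%N) (1 : fps F).
  by rewrite subnn.
exists (FPS h); apply: fps_ext => n; rewrite -hE mulrC fps_coefM.
by apply: eq_bigr => k _; rewrite mulrC.
Qed.

(** The coefficients of the powers of [f] form a lower triangular matrix with diagonal entries
    [f 1 ^+ n]. *)
Lemma fps_comp_solve f b : in_F 1 f -> exists a, fps_comp a f = b.
Proof.
move=> [/(_ 0%N isT) f0 f1].
have [n|a aE] := @triangular_solve _ (fun n k => (f ^+ k) n) b.
  by rewrite fps_exp_diag// expf_neq0.
exists (FPS a); apply: fps_ext => n; rewrite -aE.
by apply: eq_bigr => k _; rewrite mulrC.
Qed.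

(** Solving gives only a left inverse [u] of [f]. As [u] is again in F_1, it has a left inverse [v]
    too, and associativity forces [v = f], so [u] is two-sided. *)
Lemma fps_cinvP f : in_F 1 f ->
  [/\ fps_cinv f 0%N = 0, fps_comp f (fps_cinv f) = fps_X F
    & fps_comp (fps_cinv f) f = fps_X F].
Proof.
move=> fF; have f0 : f 0%N = 0 by case: fF => [+ _]; apply.
have [u uf] := fps_comp_solve (fps_X F) fF.
have u0 : u 0%N = 0 by rewrite -(fps_comp0 u f) uf.
have uF : in_F 1 u.
  split=> [[|//]//|]; apply/eqP => u1.
  have := congr1 (fun c : fps F => c 1%N) uf.
  by rewrite fps_comp1// u1 mul0r => /esym/eqP; rewrite oner_eq0.
have [v vu] := fps_comp_solve (fps_X F) uF.
have vf : v = f by rewrite -[v]fps_comp_X -uf -fps_compA// vu fps_compX.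
rewrite vf in vu.
apply: (@xgetI _ 0 [set c : fps F | [/\ c 0%N = 0, fps_comp f c = fps_X F
  & fps_comp c f = fps_X F]]%classic u).
by split.
Qed.

(** One exact quotient [c] is enough to rule out the default value of [fps_quot]. *)
Lemma fps_quotP a b c : c * b = a -> fps_quot a b * b = a.
Proof. by move=> cba; apply: (@xgetI _ 0 [set c : fps F | c * b = a]%classic c). Qed.

End FieldSeries.

(** * The recurrence between the almost-Riordan array and its production matrix *)

Section ProductionMatrix.
Variable F : fieldType.
Implicit Types a b d g f e q : fps F.

Lemma fps_mulI a : a 0%N != 0 -> injective (fun b => a * b).
Proof.
move=> /fps_inv_exists[h ah] b c /= /(congr1 ( *%R h)).
by rewrite !mulrA [h * a]mulrC ah !mul1r.
Qed.

Lemma fps_shiftDC a c : fps_shift (a + fps_const c) = fps_shift a.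
Proof. by apply: fps_ext => n /=; rewrite addr0. Qed.

Lemma almost_riordan_mulE d g f b n : f 0%N = 0 ->
  \sum_(j < n.+1) almost_riordan d g f n j * b j =
  (d * fps_const (b 0%N) + fps_X F * g * fps_comp (fps_shift b) f) n.
Proof.
move=> f0; rewrite big_ord_recl fps_coefD [d * _]mulrC fps_coefCM mulrC.
(* [fps_mul_comp] yields one term more than the matrix product; it vanishes because [X * g * f ^+ n]
   has order at least [n.+1]. *)
congr (_ + _); rewrite fps_mul_comp// big_ord_recr /=.
rewrite -[X in _ = _ + X * _]/((fps_X F * g * f ^+ n) n).
rewrite [(fps_X F * g * f ^+ n) n](_ : _ = 0) ?mul0r ?addr0//.
by rewrite -mulrA fps_coefXM; case: n => // n; rewrite fps_mul_exp_low.
Qed.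

(* Both sides of the quotient defining [q] are divisible by [f/X], which
   strips the initial term off [q(f)]. *)
Lemma fps_shift_quot g f q e : f 0%N = 0 -> f 1%N != 0 -> g 0%N != 0 ->
  e 0%N = 0 -> fps_comp q f * g = fps_shift f * e ->
  q 0%N = 0 /\ fps_X F * g * fps_comp (fps_shift q) f = e.
Proof.
move=> f0 f1 g0 e0 qgE.
have q0 : q 0%N = 0.
  have : (fps_comp q f * g) 0%N = 0 by rewrite qgE fps_coef0M e0 mulr0.
  rewrite fps_coef0M fps_comp0 => /eqP.
  by rewrite mulf_eq0 (negPf g0) orbF => /eqP.
split=> //; apply: (@fps_mulI (fps_shift f)) => //=.
rewrite -qgE [in RHS](fps_XM_shift q0) fps_compM// fps_compX//.
by rewrite [in X in _ = X * _ * _](fps_XM_shift f0); ring.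
Qed.

Lemma fps_mulXnI m : injective (fun a => fps_X F ^+ m * a).
Proof.
elim: m => [|m IHm] a b /=; first by rewrite expr0 !mul1r.
by rewrite exprS -!mulrA => /fps_XMI/IHm.
Qed.

(** After composition with [f], numerator and denominator share the factor [X ^+ m], which cancels;
    this evaluates the quotients in [A_seq], [Z_seq] and [W_seq] without handling the inverse of
    [f]. *)
Lemma fps_comp_quot f a b g s m : in_F 1 f -> g 0%N != 0 ->
  fps_comp a f = fps_X F ^+ m * s -> fps_comp b f = fps_X F ^+ m * g ->
  fps_comp (fps_quot a b) f * g = s.
Proof.
move=> fF g0 aE bE; have f0 : f 0%N = 0 by case: fF => [+ _]; apply.
have [u0 fu uf] := fps_cinvP fF; have [h gh] := fps_inv_exists g0.
have comp_fI : injective (fun c => fps_comp c f).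
  move=> c c' /(congr1 (fun c => fps_comp c (fps_cinv f))).
  by rewrite !fps_compA// fu !fps_comp_X.
apply: (@fps_mulXnI m) => /=; rewrite mulrCA -bE -fps_compM// -aE.
(* With [h] the inverse of [g], the quotient becomes [s * h] after composition with [f], so
   composing [s * h] with [fps_cinv f] provides the witness. *)
congr fps_comp; apply: (@fps_quotP _ _ _ (fps_comp (s * h) (fps_cinv f))).
apply: comp_fI; rewrite fps_compM// fps_compA// uf fps_comp_X aE bE.
by rewrite mulrCA -mulrA [h * g]mulrC gh mulr1.
Qed.

Lemma production_matrixP d g f n k :
  in_F 0 g -> d 0%N = 1 -> in_F 1 f ->
  almost_riordan d g f n.+1 k =
  \sum_(j < n.+1) almost_riordan d g f n j * production_matrix d g f j k.
Proof.
move=> [_ g0] d0 fF; have [u0 fu uf] := fps_cinvP fF.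
have f0 : f 0%N = 0 by case: fF => [+ _]; apply.
have f1 : f 1%N != 0 by case: fF.
have fE := fps_XM_shift f0.
have compK a : fps_comp (fps_comp a (fps_cinv f)) f = a.
  by rewrite fps_compA// uf fps_comp_X.
have dE : d = 1 + fps_X F * fps_shift d by rewrite {1}[d]fps_shiftE d0 rmorph1.
case: k => [|[|k]].
- rewrite (almost_riordan_mulE d g (W_seq d g f) n f0).
  rewrite -[LHS]/(fps_shift d n); congr (fps_coef _ n).
  rewrite /W_seq d0 rmorph1; set q := fps_quot _ _; set w := fps_const (d 1%N).
  (* Here [X * e = d - 1 - w * X * d], the bracket in the numerator of [W_seq] once composed with
     [f]. One factor [X] comes from it and one from [f], whence the exponent 2 below. *)
  set e := fps_shift d - w * d.
  have [||q0 qE] := @fps_shift_quot g f q e f0 f1 g0.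
  + by rewrite -[LHS]/(d 1%N - (w * d) 0%N) fps_coefCM d0 mulr1 subrr.
  + apply: (@fps_comp_quot f _ _ g _ 2%N) => //; last first.
      by rewrite fps_compM// fps_compXn// uf compK.
    rewrite !(fps_compM, fps_compB, fps_compC)// fps_compX// uf compK.
    rewrite [in LHS]fE /e {1}dE; ring.
  + rewrite fps_coefD q0 add0r fps_shiftDC qE /e /w /=; ring.
- rewrite (almost_riordan_mulE d g (Z_seq d g f) n f0).
  rewrite -[LHS]/((fps_X F * g * f ^+ 0) n.+1) mulr1 fps_coefXM; congr (fps_coef _ n).
  rewrite /Z_seq; set q := fps_quot _ _; set z := fps_const (g 0%N).
  (* The bracket in the numerator of [Z_seq] after composition with [f]; only [f] contributes a
     factor [X], whence the exponent 1. *)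
  set e := g - z * d.
  have [||q0 qE] := @fps_shift_quot g f q e f0 f1 g0.
  + by rewrite -[LHS]/(g 0%N - (z * d) 0%N) fps_coefCM d0 mulr1 subrr.
  + apply: (@fps_comp_quot f _ _ g _ 1%N) => //; last first.
      by rewrite fps_compM// uf compK.
    rewrite !(fps_compM, fps_compB, fps_compC)// fps_compX// !compK.
    rewrite [in LHS]fE /e; ring.
  + rewrite fps_coefD q0 add0r fps_shiftDC qE /e /z /=; ring.
- rewrite (almost_riordan_mulE d g (fps_X F ^+ k.+1 * A_seq f) n f0).
  rewrite -[LHS]/((fps_X F * g * f ^+ k.+1) n.+1) -mulrA [LHS]fps_coefXM.
  have AE : fps_comp (A_seq f) f = fps_shift f.
    rewrite -[LHS]mulr1; apply: (@fps_comp_quot f _ _ 1 _ 1%N) => //.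
    - by rewrite fps_coef1 oner_neq0.
    - by rewrite fps_compX.
    - by rewrite uf expr1 mulr1.
  (* The column is [X * b]: its zero constant term removes the contribution of [d], and its shift is
     [b]. *)
  set b := fps_X F ^+ k * A_seq f; rewrite [fps_X F ^+ _]exprS -[_ * A_seq f]mulrA -/b.
  rewrite [(fps_X F * b) 0%N]fps_coefXM raddf0 mulr0 add0r fps_shiftXM.
  rewrite /b fps_compM// fps_compXn// fps_compX// AE; congr (fps_coef _ n).
  by rewrite exprS {1}fE; ring.
Qed.

End ProductionMatrix.

(** A minor of the Riordan array is the minor of the almost-Riordan array with all row and column
    indices raised by one. *)
Lemma riordan_totally_positive (R : numDomainType) (d g f : fps R) :
  totally_positive (almost_riordan d g f) -> totally_positive (riordan g f).
Proof.
move=> M_tp m r c r_incr c_incr.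
have := M_tp m (fun i => (r i).+1) (fun i => (c i).+1).
rewrite (_ : (\matrix_(i, j) _) = \matrix_(i, j) riordan g f (r i) (c j)).
  by apply=> i j; rewrite ltnS; [apply: r_incr|apply: c_incr].
apply/matrixP => i j; rewrite !mxE.
rewrite -[LHS]/((fps_X R * g * f ^+ (c j)) (r i).+1).
by rewrite -mulrA fps_coefXM.
Qed.

(** * The Cauchy-Binet formula *)

Lemma det_mulmx_rowsub (R : comNzRingType) m N (A : 'M[R]_(m, N)) (B : 'M_(N, m)) :
  \det (A *m B) =
  \sum_(h : {ffun 'I_m -> 'I_N}) (\prod_i A i (h i)) * \det (rowsub h B).
Proof.
transitivity (\sum_(s : 'S_m) \sum_(h : {ffun 'I_m -> 'I_N})
  (-1) ^+ s * \prod_i (A i (h i) * B (h i) (s i))).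
  apply: eq_bigr => s _; rewrite -mulr_sumr.
  (* A product of sums expands over all choice maps [h], injective or not. *)
  rewrite -(bigA_distr_bigA (fun i j => A i j * B j (s i))).
  by congr (_ * _); apply: eq_bigr => i _; rewrite mxE.
rewrite exchange_big; apply: eq_bigr => h _ /=.
rewrite mulr_sumr; apply: eq_bigr => s _.
rewrite big_split mulrCA; do 2![congr (_ * _)].
by apply: eq_bigr => i _; rewrite mxE.
Qed.

(* Cauchy-Binet, symmetrised over all maps: the increasing maps appear up to
   the order of their values, which multiplies the usual sum by [m!]. *)
Lemma cauchy_binet_ffun (R : comNzRingType) m N (A : 'M[R]_(m, N)) (B : 'M_(N, m)) :
  \det (A *m B) *+ m`! =
  \sum_(h : {ffun 'I_m -> 'I_N}) \det (colsub h A) * \det (rowsub h B).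
Proof.
transitivity (\sum_(s : 'S_m) \det (A *m B)).
  by rewrite sumr_const -card_Sn.
transitivity (\sum_(s : 'S_m) \sum_(h : {ffun 'I_m -> 'I_N})
  ((-1) ^+ s * \prod_i A i (h (s i))) * \det (rowsub h B)); last first.
  rewrite exchange_big; apply: eq_bigr => h _ /=; rewrite -mulr_suml.
  congr (_ * _); apply: eq_bigr => s _; congr (_ * _).
  by apply: eq_bigr => i _; rewrite mxE.
apply: eq_bigr => s _; rewrite det_mulmx_rowsub.
(* For each [s], the expansion of the determinant is reindexed by [h \o s]. Undoing [s] on the rows
   of [B] produces its sign, and summing over [s] then builds [\det (colsub h A)]. *)
pose ps (h : {ffun 'I_m -> 'I_N}) := [ffun i => h (s i)].
pose ps' (h : {ffun 'I_m -> 'I_N}) := [ffun i => h (s^-1%g i)].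
rewrite (reindex_onto ps ps') /=; last first.
  by move=> h _; apply/ffunP => i; rewrite !ffunE permK.
apply: eq_big => [h|h _].
  by apply/eqP/ffunP => i; rewrite !ffunE permKV.
have -> : rowsub (ps h) B = perm_mx s *m rowsub h B.
  by rewrite -row_permE; apply/matrixP => i j; rewrite !mxE ffunE.
rewrite det_mulmx det_perm mulrA [_ * (-1) ^+ s]mulrC.
by congr (_ * _ * _); apply: eq_bigr => i _; rewrite ffunE.
Qed.

(** Sorting the indices by their values under [c] gives the permutation; injectivity makes the order
    strict. *)
Lemma incr_rearrangement m (c : 'I_m -> nat) : injective c ->
  exists s : 'S_m, {homo (c \o s) : i j / (i < j)%N}.
Proof.
move=> c_inj; pose e := sort (fun i j => c i <= c j)%N (enum 'I_m).
have sz_e : size e = m by rewrite size_sort size_enum_ord.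
have e_uniq : uniq e by rewrite sort_uniq enum_uniq.
have t_inj : injective (tnth (Tuple (introT eqP sz_e))).
  by apply/tuple_uniqP.
exists (perm t_inj) => i j lt_ij /=; rewrite !permE.
have leT : total (fun i j => c i <= c j)%N by move=> x y; apply: leq_total.
have := sort_sorted leT (enum 'I_m); rewrite -/e => e_sorted.
have tr : transitive (fun i j => c i <= c j)%N by move=> y x z; apply: leq_trans.
have := sorted_leq_nth tr (fun x => leqnn (c x)) i e_sorted.
have lt_e (l : 'I_m) : (l < size e)%N by rewrite sz_e.
move/(_ i j (lt_e i) (lt_e j) (ltnW lt_ij)).
rewrite leq_eqVlt !(tnth_nth i) /= => /orP[/eqP/c_inj|//].
move/eqP; rewrite nth_uniq ?sz_e// => /eqP ij.
by rewrite ij ltnn in lt_ij.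
Qed.

(** * Nonnegativity of minors of a product *)

Section MinorProducts.
Variables (R : numDomainType) (M J P : nat -> nat -> R) (N : nat).

(* Rearranging the middle indices multiplies both minors by the same sign. *)
Lemma minor_mul_ge0 m (r c k : 'I_m -> nat) :
  (forall k' : 'I_m -> nat, {homo k' : i j / (i < j)%N} ->
    0 <= \det (\matrix_(i < m, j < m) M (r i) (k' j))) ->
  (forall k' : 'I_m -> nat, {homo k' : i j / (i < j)%N} ->
    0 <= \det (\matrix_(i < m, j < m) J (k' i) (c j))) ->
  0 <= \det (\matrix_(i < m, j < m) M (r i) (k j)) *
       \det (\matrix_(i < m, j < m) J (k i) (c j)).
Proof.
move=> M_ge0 J_ge0; have [/injectiveP k_inj|] := boolP (injectiveb k).
  have [s ks] := incr_rearrangement k_inj.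
  have -> : \det (\matrix_(i, j) M (r i) (k j)) =
      (-1) ^+ s * \det (\matrix_(i, j) M (r i) (k (s j))).
    rewrite -[in RHS]det_tr; set B := (_^T).
    have -> : B = perm_mx s *m (\matrix_(i, j) M (r i) (k j))^T.
      by rewrite -row_permE; apply/matrixP => i j; rewrite !mxE.
    by rewrite det_mulmx det_perm det_tr mulrA -signr_addb addbb mul1r.
  have -> : \det (\matrix_(i, j) J (k i) (c j)) =
      (-1) ^+ s * \det (\matrix_(i, j) J (k (s i)) (c j)).
    set B := (X in _ = _ * \det X).
    have -> : B = perm_mx s *m \matrix_(i, j) J (k i) (c j).
      by rewrite -row_permE; apply/matrixP => i j; rewrite !mxE.
    by rewrite det_mulmx det_perm mulrA -signr_addb addbb mul1r.
  rewrite mulrACA -signr_addb addbb mul1r.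
  by apply: mulr_ge0; [apply: M_ge0 ks | apply: J_ge0 ks].
move=> /injectivePn[i [j ne_ij kij]].
rewrite [X in _ * X](determinant_alternate ne_ij) ?mulr0// => l.
by rewrite !mxE kij.
Qed.

(** The rows [r] and columns [c] are fixed, so that only minors of [M] on these rows have to be
    nonnegative; an induction on row indices can supply that. *)
Lemma minor_of_product_ge0 m (r c : 'I_m -> nat) :
  (forall i j, P (r i) (c j) = \sum_(k < N) M (r i) k * J k (c j)) ->
  (forall k : 'I_m -> nat, {homo k : i j / (i < j)%N} ->
    0 <= \det (\matrix_(i < m, j < m) M (r i) (k j))) ->
  (forall k : 'I_m -> nat, {homo k : i j / (i < j)%N} ->
    0 <= \det (\matrix_(i < m, j < m) J (k i) (c j))) ->
  0 <= \det (\matrix_(i < m, j < m) P (r i) (c j)).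
Proof.
move=> P_MJ M_ge0 J_ge0.
pose A := \matrix_(i < m, k < N) M (r i) k.
pose B := \matrix_(k < N, j < m) J k (c j).
have -> : \matrix_(i, j) P (r i) (c j) = A *m B.
  by apply/matrixP => i j; rewrite !mxE P_MJ; apply: eq_bigr => k _; rewrite !mxE.
(* The factor [m!] of the symmetrised formula is positive and does not affect the sign. *)
rewrite -(pmulrn_lge0 _ (fact_gt0 m)) cauchy_binet_ffun.
apply: sumr_ge0 => h _.
have -> : colsub h A = \matrix_(i, j) M (r i) (nat_of_ord (h j)).
  by apply/matrixP => i j; rewrite !mxE.
have -> : rowsub h B = \matrix_(i, j) J (nat_of_ord (h i)) (c j).
  by apply/matrixP => i j; rewrite !mxE.
exact: (@minor_mul_ge0 _ r c (fun i => h i)).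
Qed.

End MinorProducts.

(** * Total positivity passes from the production matrix to the array *)

Lemma production_totally_positive (R : numDomainType) (M J : infmx R) :
  (forall k, M 0%N k = (k == 0%N)%:R) ->
  (forall n k, M n.+1 k = \sum_(j < n.+1) M n j * J j k) ->
  (forall n k, (n < k)%N -> M n k = 0) ->
  totally_positive J -> totally_positive M.
Proof.
move=> M0 MS M_low J_tp.
suff tpN N m (r c : 'I_m -> nat) : (forall i, r i < N)%N ->
    {homo r : i j / (i < j)%N} -> {homo c : i j / (i < j)%N} ->
    0 <= \det (\matrix_(i, j) M (r i) (c j)).
  move=> m r c; apply: (tpN (\max_i r i).+1) => i.
  by rewrite ltnS leq_bigmax.
elim: N m r c => [|N IHN] m r c.
  case: m r c => [|m] r c; first by rewrite det_mx00 ler01.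
  by move/(_ ord0).
(* Minors avoiding row 0 come first, for every size [q]: the case with row 0 reduces to them after
   expansion. *)
have shifted q (r' c' : 'I_q -> nat) : (forall i, 0 < r' i < N.+1)%N ->
    {homo r' : i j / (i < j)%N} -> {homo c' : i j / (i < j)%N} ->
    0 <= \det (\matrix_(i, j) M (r' i) (c' j)).
  move=> r'N r'_incr c'_incr.
  have r'S i : r' i = (r' i).-1.+1 by case/andP: (r'N i); case: (r' i).
  rewrite (_ : (\matrix_(i, j) _) =
    \matrix_(i, j) (fun n k => M n.+1 k) (r' i).-1 (c' j)); last first.
    by apply/matrixP => i j; rewrite !mxE -r'S.
  apply: (@minor_of_product_ge0 _ M J (fun n k => M n.+1 k) N.+1 _
            (fun i => (r' i).-1)).
  - move=> i j; rewrite MS.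
    (* The recurrence has a length depending on the row; triangularity of [M] pads all of them with
       zeros to the common length [N.+1]. *)
    have le_rN : ((r' i).-1.+1 <= N.+1)%N.
      by rewrite -r'S; case/andP: (r'N i) => _ /ltnW.
    rewrite (big_ord_widen _ (fun k => M (r' i).-1 k * J k (c' j)) le_rN).
    rewrite big_mkcond; apply: eq_bigr => k _; case: ifPn => //.
    by rewrite -leqNgt => lt_rk; rewrite M_low ?mul0r.
  - move=> k k_incr; apply: IHN => // [i|i j lt_ij].
      by rewrite -ltnS -r'S; case/andP: (r'N i).
    by rewrite -ltnS -!r'S r'_incr.
  - by move=> k k_incr; apply: J_tp.
move=> rN r_incr c_incr.
case: m => [|m] in r c rN r_incr c_incr *; first by rewrite det_mx00 ler01.
have [r0|r0] := posnP (r ord0); last first.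
  apply: shifted => // i; rewrite rN andbT.
  by case: (unliftP ord0 i) => [j|] -> //; rewrite (ltn_trans r0)// r_incr.
(* Later columns have positive index, so row 0 of [M] vanishes there and only the first term of the
   expansion survives. Its cofactor uses rows above [r ord0 = 0], so [shifted] applies. *)
rewrite (expand_det_row _ ord0) big_ord_recl big1 => [|j _]; last first.
  rewrite mxE r0 M0 gtn_eqF ?mul0r//.
  by rewrite (leq_ltn_trans _ (c_incr ord0 _ _)).
rewrite addr0 mxE r0 M0 /cofactor addn0 expr0 mul1r.
apply: mulr_ge0; first by rewrite ler0n.
rewrite (_ : row' _ _ = \matrix_(i, j) M (r (lift ord0 i)) (c (lift ord0 j))).
  apply: shifted => [i|i j lt_ij|i j lt_ij].
  - by rewrite rN andbT -r0 r_incr.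
  - exact: r_incr.
  - exact: c_incr.
by apply/matrixP => i j; rewrite !mxE.
Qed.

Theorem proposition3p1 (R : realType) (d g f : fps R)
  (hd : in_F 0 d) (hg : in_F 0 g) (hd0 : d 0%N = 1) (hf : in_F 1 f)
  (hJ : totally_positive (production_matrix d g f)) :
  totally_positive (almost_riordan d g f) /\ totally_positive (riordan g f).
Proof.
have f0 : f 0%N = 0 by case: hf => [+ _]; apply.
have M_low n k : (n < k)%N -> almost_riordan d g f n k = 0.
  case: k => // k; rewrite ltnS => le_nk.
  rewrite -[LHS]/((fps_X R * g * f ^+ k) n) -mulrA fps_coefXM.
  by case: n le_nk => // n lt_nk; apply: fps_mul_exp_low.
suff M_tp : totally_positive (almost_riordan d g f).
  by split=> //; apply: riordan_totally_positive M_tp.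
apply: production_totally_positive hJ => // [[//|k]|n k].
  exact: M_low.
exact: production_matrixP.
Qed.
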